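(* Let $\mathcal{H}$ and $\mathcal{D}$ be real Hilbert spaces, let $\mathcal{A}:\mathcal{H}\to2^{\mathcal{H}}$ be a maximal monotone operator which has at least one zero, and let $\mathcal{C}:\mathcal{D}\to\mathcal{H}$ be a linear, bounded and injective operator with $\mathcal{C}^*$ onto such that $\mathcal{C}\mathcal{C}^*$ is an admissible preconditioner of $\mathcal{A}$. Let $\sigma\in[0,1)$, let $\lambda_k>0$ ($k\ge1$) satisfy $\inf_k\lambda_k>0$, let $w^0\in\mathcal{D}$, and let $\{w^k\}_{k\ge0}\subset\mathcal{D}$, $\{z^k\}_{k\ge1}\subset\mathcal{D}$, $\{\tilde u^k\}_{k\ge1}\subset\mathcal{H}$ be sequences such that for all $k\ge0$ $$\mathcal{C}z^{k+1}\in\mathcal{A}\tilde u^{k+1},$$ $$\|\lambda_{k+1}z^{k+1}+\mathcal{C}^*\tilde u^{k+1}-w^k\|\le\sigma\|\mathcal{C}^*\tilde u^{k+1}-w^k\|,$$ $$w^{k+1}=w^k-\lambda_{k+1}z^{k+1}.$$ Then the sequence $\{w^k\}$ converges weakly to some $w^*\in\mathcal{D}$ which is a zero of $\mathcal{C}^*\triangleright\mathcal{A}$. Moreover, $u^*=(\mathcal{C}\mathcal{C}^*+\mathcal{A})^{-1}\mathcal{C}w^*$ is a zero of $\mathcal{A}$, and if $(\mathcal{C}\mathcal{C}^*+\mathcal{A})^{-1}$ is Lipschitz continuous, then $\{\tilde u^k\}$ converges weakly to $u^*$.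
   Context: A zero of a multivalued operator $T$ is a point $u$ with $0\in Tu$. An admissible preconditioner for $\mathcal{A}:\mathcal{H}\to2^{\mathcal{H}}$ is a linear, bounded, self-adjoint and positive semidefinite operator $\mathcal{M}:\mathcal{H}\to\mathcal{H}$ such that $(\mathcal{M}+\mathcal{A})^{-1}\mathcal{M}$ is single-valued and has full domain. For a multivalued map $A:\mathcal{H}_1\to2^{\mathcal{H}_1}$ and a bounded linear operator $K:\mathcal{H}_1\to\mathcal{H}_2$ between real Hilbert spaces, the parallel composition is $K\triangleright A=(KA^{-1}K^* )^{-1}:\mathcal{H}_2\to2^{\mathcal{H}_2}$; thus $\mathcal{C}^*\triangleright\mathcal{A}=(\mathcal{C}^*\mathcal{A}^{-1}\mathcal{C})^{-1}$ on $\mathcal{D}$. ''$(\mathcal{C}\mathcal{C}^*+\mathcal{A})^{-1}$ is Lipschitz continuous'' means that this set-valued inverse is point-to-point (single-valued on its domain) and Lipschitz continuous with respect to the norm of $\mathcal{H}$. *)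

(* Defs.v *)
From HB Require Import structures.
From mathcomp Require Import all_boot all_order all_algebra.
From mathcomp Require Import all_classical all_reals all_analysis.

Set Implicit Arguments.
Unset Strict Implicit.
Unset Printing Implicit Defensive.

Import Order.TTheory GRing.Theory Num.Theory.
Import numFieldNormedType.Exports.

Local Open Scope classical_set_scope.
Local Open Scope ring_scope.

HB.mixin Record CompleteNormedModule_isHilbert (R : realType) V
    of CompleteNormedModule R V := {
  inner : {dot V for idfun} ;
  normE_inner : forall x : V, `|x| = Num.sqrt (inner x x)
}.

#[short(type="hilbertType")]
HB.structure Definition Hilbert (R : realType) :=
  {V of CompleteNormedModule_isHilbert R V & CompleteNormedModule R V}.

Arguments inner {R s}.

Section BoundedOperators.
Context {R : realType}.
Implicit Types H K : hilbertType R.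

Definition bounded_op H K (f : H -> K) : Prop :=
  exists c : R, forall x, `|f x| <= c * `|x|.

Definition self_adjoint H (M : H -> H) : Prop :=
  forall x y, inner (M x) y = inner x (M y).

Definition positive_semidefinite H (M : H -> H) : Prop :=
  forall x, 0 <= inner (M x) x.

(* The Hilbert adjoint, pointwise the Riesz representative of
   [x |-> <f x, y>]: for f linear and bounded it exists and is unique, so the
   default value 0 of [xget] is irrelevant there. *)
Definition adjoint H K (f : H -> K) : K -> H :=
  fun y => xget 0 [set z | forall x, inner (f x) y = inner x z].

(* By Riesz representation, every continuous linear functional on H is
   [x |-> <x, y>] for some y. *)
Definition weakly_cvg H (u : nat -> H) (l : H) : Prop :=
  forall y, inner (u n) y @[n --> \oo] --> inner l y.

End BoundedOperators.

(* A multivalued operator T : H -> 2^K is a function [H -> set K]; [T x y]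
   reads y \in T x. *)
Section MultivaluedOperators.
Context {T1 T2 T3 : Type}.

Definition mv_of_fun (f : T1 -> T2) : T1 -> set T2 := fun x => [set f x].

Definition mv_inv (T : T1 -> set T2) : T2 -> set T1 :=
  fun y => [set x | T x y].

Definition mv_comp (S : T2 -> set T3) (T : T1 -> set T2) : T1 -> set T3 :=
  fun x => \bigcup_(y in T x) S y.

Definition single_valued (T : T1 -> set T2) : Prop :=
  forall x y z, T x y -> T x z -> y = z.

Definition full_domain (T : T1 -> set T2) : Prop := forall x, T x !=set0.

End MultivaluedOperators.

Section MonotoneOperators.
Context {R : realType}.
Implicit Types H K : hilbertType R.

Definition mv_add H K (S T : H -> set K) : H -> set K :=
  fun x => [set u + v | u in S x & v in T x].

Definition zero_of H K (T : H -> set K) (x : H) : Prop := T x 0.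

Definition monotone_op H (A : H -> set H) : Prop :=
  forall x y u v, A x u -> A y v -> 0 <= inner (x - y) (u - v).

Definition maximal_monotone H (A : H -> set H) : Prop :=
  monotone_op A /\
  forall B : H -> set H, monotone_op B -> (forall x, A x `<=` B x) -> B = A.

(* Lipschitz on its domain, which need not be the whole space. *)
Definition lipschitz_op H K (T : H -> set K) : Prop :=
  single_valued T /\
  exists L : R, forall x y u v, T x u -> T y v -> `|u - v| <= L * `|x - y|.

Definition admissible_preconditioner H (A : H -> set H) (M : H -> H) : Prop :=
  [/\ linear M, bounded_op M, self_adjoint M, positive_semidefinite M &
      let T := mv_comp (mv_inv (mv_add (mv_of_fun M) A)) (mv_of_fun M) in
      single_valued T /\ full_domain T].

Definition parallel_composition H K (L : H -> K) (A : H -> set H) :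
    K -> set K :=
  mv_inv (mv_comp (mv_of_fun L) (mv_comp (mv_inv A) (mv_of_fun (adjoint L)))).

End MonotoneOperators.

(* Main.v *)
Require Import Defs.
From HB Require Import structures.
From mathcomp Require Import all_boot all_order all_algebra.
From mathcomp Require Import all_classical all_reals all_analysis.
From mathcomp Require Import ring lra.

Set Implicit Arguments.
Unset Strict Implicit.
Unset Printing Implicit Defensive.

Import Order.TTheory GRing.Theory Num.Theory.
Import numFieldNormedType.Exports.

Local Open Scope classical_set_scope.
Local Open Scope ring_scope.

(** The sequence [w] is produced by an inexact proximal point method, the
hybrid proximal extragradient (HPE) method, applied to
[B := C^* |> A].  Since [C^*] is onto and [C C^*] is admissible, [I + B] is onto;
as [B] is also monotone, its graph contains every pair that is monotonically
related to it ([resolvent_monotone_closed]).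

Put [v k := C^* (u (k+1))] and shift [z] and [lambda] likewise.  For each zero
[s] of [B], the relative error criterion gives the inequality
[|w (k+1) - s|^2 + (1 - sigma^2) |v k - w k|^2 <= |w k - s|^2]
([hpe_fejer]).  Hence [|w k - s|] converges, [v k - w k] tends to [0], and [z k]
tends to [0] because the step sizes are bounded away from [0].  A weak limit of
[w] along any ultrafilter is then a weak limit of [v], along which
[z k \in B (v k)] tends strongly to [0], so it is a zero of [B]
([weak_strong_closed]); Opial's argument ([opial]) shows that there is only one
such limit.

The limit [wstar] is [C^* ustar] for some zero [ustar] of [A], and [ustar] is
then the only point of [(C C^* + A)^-1 (C wstar)] because
[(C C^* + A)^-1 C C^*] is single-valued.  As [u (k+1)] belongs to
[(C C^* + A)^-1 (C (z k + v k))], the Lipschitz hypothesis bounds [u].  Every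
ultrafilter limit of [u] is a zero of [A], by maximality of [A] and because
[C z] tends to [0]; its image by [C^*] is [wstar], hence it is [ustar].

Weak compactness comes from ultrafilters: the scalar products of a bounded
sequence with any fixed vector converge along an ultrafilter, and the Riesz
representation theorem ([riesz]) turns the resulting bounded functional into a
vector. *)

(** * Inner products and the Riesz representation theorem *)

Section Inner.
Context {R : realType} {V : hilbertType R}.
Implicit Types (x y z h : V) (a : R).

Lemma innerC x y : inner x y = inner y x.
Proof. by rewrite hermC/= expr0 mul1r. Qed.

Lemma innerDl x y z : inner (x + y) z = inner x z + inner y z.
Proof. exact: linearDl. Qed.

Lemma innerDr x y z : inner z (x + y) = inner z x + inner z y.
Proof. exact: linearDr. Qed.

Lemma innerNl x y : inner (- x) y = - inner x y.
Proof. exact: linearNl. Qed.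

Lemma innerNr x y : inner x (- y) = - inner x y.
Proof. exact: linearNr. Qed.

Lemma innerZl a x y : inner (a *: x) y = a * inner x y.
Proof. exact: linearZl_LR. Qed.

Lemma innerZr a x y : inner x (a *: y) = a * inner x y.
Proof. exact: linearZr_LR. Qed.

Lemma inner0l x : inner 0 x = 0.
Proof. exact: linear0l. Qed.

Lemma inner_ge0 x : 0 <= inner x x.
Proof.
by have [->|x0] := eqVneq x 0; [rewrite inner0l|exact/ltW/neq0_dnorm_gt0].
Qed.

Lemma inner_normE x : inner x x = `|x| ^+ 2.
Proof. by rewrite normE_inner sqr_sqrtr// inner_ge0. Qed.

Lemma inner_eq0 x : inner x x = 0 -> x = 0.
Proof. by rewrite inner_normE => /eqP; rewrite sqrf_eq0 normr_eq0 => /eqP. Qed.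

Definition innerE := (innerDl, innerDr, innerNl, innerNr, innerZl, innerZr).

Lemma norm_sqrD x y : `|x + y| ^+ 2 = `|x| ^+ 2 + inner x y *+ 2 + `|y| ^+ 2.
Proof. rewrite -!inner_normE !innerE (innerC y x); ring. Qed.

Lemma norm_sqrB x y : `|x - y| ^+ 2 = `|x| ^+ 2 - inner x y *+ 2 + `|y| ^+ 2.
Proof. by rewrite norm_sqrD innerNr normrN mulNrn. Qed.

(** The Cauchy-Schwarz inequality is the squared triangle inequality of the
norm, which the normed space structure already provides. *)
Lemma inner_le_norm x y : inner x y <= `|x| * `|y|.
Proof.
have : `|x + y| ^+ 2 <= (`|x| + `|y|) ^+ 2.
  by rewrite lerXn2r ?nnegrE// ler_normD.
by rewrite norm_sqrD; nra.
Qed.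

Lemma cauchy_schwarz x y : `|inner x y| <= `|x| * `|y|.
Proof.
by rewrite ler_norml inner_le_norm lerNl -innerNl -(normrN x) inner_le_norm.
Qed.

Lemma inner_inj x y : (forall h, inner x h = inner y h) -> x = y.
Proof.
move=> xy; apply/eqP; rewrite -subr_eq0; apply/eqP/inner_eq0.
by rewrite innerDl xy innerNl subrr.
Qed.

(** The representing vector minimises [J x = |x|^2 / 2 - phi x].  The sublevel
sets of [J] just above its infimum generate a Cauchy filter by the parallelogram
law; comparing [J] at [x] and at [x +- t h] shows that [<x, h>] tends to [phi h]
along this filter, so its limit represents [phi]. *)
Lemma riesz (phi : V -> R) (c : R) :
    (forall a x y, phi (a *: x + y) = a * phi x + phi y) ->
    (forall x, `|phi x| <= c * `|x|) ->
  exists z, forall x, phi x = inner x z.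
Proof.
move=> phiL phiB.
have phi0 : phi 0 = 0 by have := phiL 1 0 0; rewrite scaler0 addr0; lra.
have phiD x y : phi (x + y) = phi x + phi y.
  by rewrite -[x]scale1r phiL scale1r mul1r.
have phiZ a x : phi (a *: x) = a * phi x.
  by rewrite -[a *: x]addr0 phiL phi0 addr0.
pose J x := `|x| ^+ 2 / 2 - phi x.
have Jlb x : - (c ^+ 2 / 2) <= J x.
  have := phiB x; rewrite ler_norml /J => /andP[_].
  have := sqr_ge0 (`|x| - c); lra.
have hJ : has_inf (range J).
  by split; [exists (J 0); exists 0|exists (- (c ^+ 2 / 2)) => _ [x _ <-]].
pose m := inf (range J).
have mle x : m <= J x by apply: ge_inf; [case: hJ|exists x].
pose S e := [set x | J x < m + e].
pose F : set_system V := filter_from [set e | 0 < e] S.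
have FF : ProperFilter F.
  apply: filter_from_proper; last first.
    by move=> e e0; have [_ [x _ <-] xe] := inf_adherent e0 hJ; exists x.
  apply: filter_from_filter; first by exists 1; exact: ltr01.
  move=> i j i0 j0; exists (Num.min i j); first by rewrite /= lt_min i0.
  by move=> x; rewrite /S/= => /lt_le_trans xij; split; apply: xij;
    rewrite lerD2l ge_min lexx ?orbT.
have Fcauchy : cauchy F.
  apply: cauchy_exP => e e0.
  (* the parallelogram law bounds |x - y|^2 / 8 by the excess of J at x and y
     over its infimum, each at most e^2 / 16 *)
  have e16 : 0 < e ^+ 2 / 16 by apply: divr_gt0 => //; exact: exprn_gt0.
  have [_ [x _ <-] xe] := inf_adherent e16 hJ; exists x.
  exists (e ^+ 2 / 16) => // y; rewrite /S /= => ye.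
  rewrite -ball_normE /=.
  suff : `|x - y| ^+ 2 < e ^+ 2.
    by rewrite ltr_pXn2r// ?nnegrE// ltW.
  have := mle (2^-1 *: (x + y)); move: xe ye.
  rewrite -/m /J phiZ phiD normrZ exprMn (norm_sqrD x y) norm_sqrB.
  by rewrite normfV ger0_norm//; lra.
have /cauchy_cvgP/cvg_ex[l Fl] := Fcauchy; exists l => h.
have cvh : inner x h @[x --> F] --> inner l h.
  apply/cvgrPdist_le => e e0.
  have h0 : 0 < `|h| + 1 by rewrite ltr_wpDl.
  have /cvgrPdist_le/(_ _ (divr_gt0 e0 h0)) : id @ F --> l by [].
  apply: filterS => x xl; rewrite -innerNl -innerDl.
  apply: (le_trans (cauchy_schwarz _ _)).
  have : e / (`|h| + 1) * (`|h| + 1) = e by rewrite divfK// gt_eqF.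
  have := normr_ge0 h; have := normr_ge0 (l - x); nra.
suff cvp : inner x h @[x --> F] --> phi h.
  by rewrite innerC; apply: (cvg_unique _ cvp cvh).
apply/cvgrPdist_le => d d0.
(* the error t |h|^2 / 2 of the difference quotient must stay below d / 2 *)
pose t := d / (`|h| ^+ 2 + 1).
have h0 : 0 < `|h| ^+ 2 + 1 by rewrite ltr_wpDl// sqr_ge0.
have t0 : 0 < t by rewrite divr_gt0.
have td : t * (`|h| ^+ 2 + 1) = d by rewrite divfK// gt_eqF.
exists (t * d / 2); first by rewrite /= divr_gt0// mulr_gt0.
move=> x; rewrite /S /= => xm.
have key s : s ^+ 2 = t ^+ 2 ->
    0 <= t * d / 2 + s * (inner x h - phi h) + t ^+ 2 * `|h| ^+ 2 / 2.
  move=> st; have := mle (s *: h + x); move: xm.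
  rewrite /J phiD phiZ norm_sqrD innerZl normrZ exprMn real_normK ?num_real//.
  by rewrite st (innerC h); lra.
(* the two signs of the increment bound the difference from both sides *)
have k1 := key t erefl; have k2 := key (- t) (sqrrN t).
rewrite ler_norml; apply/andP; split; rewrite -(ler_pM2l t0); nra.
Qed.

End Inner.

(** * Weak limits along ultrafilters *)

Section Ultra.

(** If some preimage of a neighbourhood is not in [F], an ultrafilter refining
[F] contains its complement. *)
Lemma cvg_ultra {I : Type} {T : topologicalType} (F : set_system I)
    {FF : Filter F} (f : I -> T) (l : T) :
  (forall U, UltraFilter U -> F `<=` U -> f @ U --> l) -> f @ F --> l.
Proof.
move=> Ul N Nl; apply: contrapT => nFN.
pose G := within (~` (f @^-1` N)) F.
have GP : ProperFilter G.
  split; last exact: within_filter.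
  move=> G0; apply: nFN; change (F (f @^-1` N)).
    by apply: filterS (G0 : F _) => n nNn; apply: contrapT => /nNn.
have [U [UU GU]] := ultraFilterLemma GP.
have FU : F `<=` U by move=> P FP; apply: GU; exact: (@cvg_within _ F _ _ P FP).
have UN : U (f @^-1` N) by exact: (Ul U UU FU).
have UnN : U (~` (f @^-1` N)) by apply: GU; exact: withinT.
by apply: (@filter_not_empty _ U _); apply: filterS (filterI UN UnN) => n [].
Qed.

(** A cluster point of [f] along an ultrafilter is its limit. *)
Lemma ultra_bounded_cvg {R : realType} {I : Type} (U : set_system I)
    (f : I -> R) (M : R) : UltraFilter U -> (forall n, `|f n| <= M) ->
  cvg (f @ U).
Proof.
move=> UU fM.
have [p [_ clp]] : `[-M, M]%classic `&` cluster (f @ U) !=set0.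
  apply: (@segment_compact R (- M) M); apply: (@filterE _ U) => n /=.
  by rewrite in_itv/= -ler_norml.
apply: (cvgP p) => N Np; have [//|UnN] := in_ultra_setVsetC (f @^-1` N) UU.
by have [x [/= nNx Nx]] := clp (~` N) N UnN Np.
Qed.

Context {R : realType} {V : hilbertType R}.

(** [weakly_cvg u l] is the case [F = \oo]. *)
Definition weak_lim {I : Type} (F : set_system I) (u : I -> V) (l : V) : Prop :=
  forall y, inner (u n) y @[n --> F] --> inner l y.

Lemma weak_lim_unique {I : Type} (F : set_system I) {FF : ProperFilter F}
    (u : I -> V) (l l' : V) :
  weak_lim F u l -> weak_lim F u l' -> l = l'.
Proof.
by move=> ul ul'; apply: inner_inj => y; exact: (cvg_unique _ (ul y) (ul' y)).
Qed.

Lemma weak_lim_sub {I : Type} (F G : set_system I) (u : I -> V) (l : V) :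
  G `<=` F -> weak_lim G u l -> weak_lim F u l.
Proof. by move=> GF ul y; apply: cvg_trans (ul y); exact: cvg_app. Qed.

(** The limits of the scalar products with [y] form a bounded linear functional
of [y], which is represented by the weak limit. *)
Lemma ultra_weak_lim {I : Type} (U : set_system I) (u : I -> V) (M : R) :
  UltraFilter U -> (forall n, `|u n| <= M) -> exists l, weak_lim U u l.
Proof.
move=> UU uM.
have bnd n y : `|inner (u n) y| <= M * `|y|.
  by apply: le_trans (cauchy_schwarz _ _) _; rewrite ler_wpM2r.
pose phi y := lim (inner (u n) y @[n --> U]).
have phiE y : inner (u n) y @[n --> U] --> phi y.
  exact: (ultra_bounded_cvg UU (bnd^~ y)).
have [l phil] : exists l, forall y, phi y = inner y l.
  apply: (@riesz _ _ _ M) => [a x y|x].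
    apply: (cvg_unique _ (phiE _)) => //=.
    have -> : (fun n => inner (u n) (a *: x + y)) =
              (fun n => a * inner (u n) x + inner (u n) y).
      by apply/funext => n; rewrite innerDr innerZr.
    by apply: cvgD (phiE y); apply: cvgMl_tmp.
  rewrite ler_norml; apply/andP; split.
    apply: (cvgr_to_ge (phiE x)); apply: nearW => n.
    by have := bnd n x; rewrite ler_norml => /andP[].
  apply: (cvgr_to_le (phiE x)); apply: nearW => n.
  by have := bnd n x; rewrite ler_norml => /andP[].
by exists l => y; rewrite innerC -phil.
Qed.

(** For a bounded sequence a weak limit exists along every ultrafilter, so only
its value has to be identified. *)
Lemma weakly_cvg_ultra (u : nat -> V) (l : V) (M : R) :
    (forall n, `|u n| <= M) ->
    (forall U l', UltraFilter U -> \oo `<=` U -> weak_lim U u l' -> l' = l) ->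
  weakly_cvg u l.
Proof.
move=> uM ul y; apply: cvg_ultra => U UU ooU.
have [l' ul'] := ultra_weak_lim UU uM.
by rewrite -(ul U l').
Qed.

(** Two ultrafilter limits [p] and [q] lie in [S], so the difference
[|w n - p|^2 - |w n - q|^2], which is affine in [w n], converges; evaluating its
limit along both ultrafilters gives [<p, p - q> = <q, p - q>]. *)
Lemma opial (S : set V) (w : nat -> V) (M : R) :
    (forall n, `|w n| <= M) ->
    (forall s, S s -> cvg (`|w n - s| ^+ 2 @[n --> \oo])) ->
    (forall U l, UltraFilter U -> \oo `<=` U -> weak_lim U w l -> S l) ->
  exists2 l, S l & weakly_cvg w l.
Proof.
move=> wM cvgS Slim.
have [U0 [UU0 ooU0]] := ultraFilterLemma eventually_filter.
have [p wp] := ultra_weak_lim UU0 wM.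
have Sp : S p by exact: (Slim U0).
exists p => //; apply: (weakly_cvg_ultra wM) => U q UU ooU wq.
have Sq : S q by exact: (Slim U).
pose d n := `|w n - p| ^+ 2 - `|w n - q| ^+ 2.
have /cvg_ex[L dL] : cvg (d n @[n --> \oo]).
  by apply: is_cvgB; exact: cvgS.
have dE n : d n = `|p| ^+ 2 - `|q| ^+ 2 - 2 * inner (w n) (p - q).
  by rewrite /d !norm_sqrB innerDr innerNr; lra.
have limd U' r : UltraFilter U' -> \oo `<=` U' -> weak_lim U' w r ->
    `|p| ^+ 2 - `|q| ^+ 2 - 2 * inner r (p - q) = L.
  move=> UU' ooU' wr; apply: (@cvg_unique _ _ (d @ U')) => //.
    rewrite (funext dE); apply: cvgB; first exact: cvg_cst.
    by apply: cvgMl_tmp; exact: wr.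
  by apply: cvg_trans dL; apply: cvg_app.
have := limd _ _ UU0 ooU0 wp; have := limd _ _ UU ooU wq => eq eq'.
apply/eqP; rewrite eq_sym -subr_eq0; apply/eqP/inner_eq0.
by rewrite innerDl innerNl; lra.
Qed.

Lemma weak_lim_near {I : Type} (F : set_system I) {FF : Filter F}
    (u v : I -> V) (l : V) :
  `|u n - v n| @[n --> F] --> (0 : R) -> weak_lim F u l -> weak_lim F v l.
Proof.
move=> uv ul y.
have d0 : inner (u n - v n) y @[n --> F] --> (0 : R).
  have h : `|u n - v n| * `|y| @[n --> F] --> (0 : R).
    by rewrite -[X in _ --> X](mul0r `|y|); apply: cvgMr_tmp.
  have hN : - (`|u n - v n| * `|y|) @[n --> F] --> (0 : R).
    by rewrite -[X in _ --> X]oppr0; apply: cvgN.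
  apply: (squeeze_cvgr _ hN h); apply: nearW => n.
  by rewrite -ler_norml cauchy_schwarz.
have -> : (fun n => inner (v n) y) =
          (fun n => inner (u n) y - inner (u n - v n) y).
  by apply/funext => n; rewrite innerDl innerNl; lra.
by rewrite -[X in _ --> X]subr0; apply: cvgB.
Qed.

(** Move [z n] to the right: in [<v n - y, b> <= <v n - y, z n>] the left side
tends to [<x - y, b>] and the right side is at most [(M + |y|) |z n|]. *)
Lemma monotone_weak_strong_lim {I : Type} (F : set_system I)
    {FF : ProperFilter F} (v z : I -> V) (x y b : V) (M : R) :
  (forall n, `|v n| <= M) -> weak_lim F v x -> `|z n| @[n --> F] --> (0 : R) ->
  (forall n, 0 <= inner (v n - y) (z n - b)) -> 0 <= inner (x - y) (0 - b).
Proof.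
move=> vM vx z0 mon; rewrite sub0r innerNr oppr_ge0.
have lhs : inner (v n - y) b @[n --> F] --> inner (x - y) b.
  rewrite innerDl.
  have -> : (fun n => inner (v n - y) b) =
            (fun n => inner (v n) b + inner (- y) b).
    by apply/funext => n; rewrite innerDl.
  by apply: cvgD; [exact: vx|exact: cvg_cst].
have rhs : (M + `|y|) * `|z n| @[n --> F] --> (0 : R).
  by rewrite -[X in _ --> X](mulr0 (M + `|y|)); apply: cvgMl_tmp.
rewrite -oppr_ge0 -sub0r; apply: (cvgr_to_ge (cvgB rhs lhs)); apply: nearW => n.
rewrite /= subr_ge0; have := mon n.
rewrite innerDr innerNr subr_ge0 => /le_trans; apply.
apply: (le_trans (inner_le_norm _ _)); apply: ler_wpM2r => //.
by rewrite (le_trans (ler_normB _ _))// lerD2r.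
Qed.

End Ultra.

(** * Adjoints of bounded linear operators *)

Lemma adjoint_eq {R : realType} {H K : hilbertType R} (f : H -> K) y z :
  (forall x, inner (f x) y = inner x z) -> adjoint f y = z.
Proof.
move=> fyz; apply: inner_inj => h; rewrite -!(innerC h) -fyz.
rewrite (@xgetPex _ 0 [set z' | forall x, inner (f x) y = inner x z'])//.
by exists z.
Qed.

Section Adjoint.
Context {R : realType} {H K : hilbertType R}.

Lemma inner_adjoint (f : {linear H -> K}) : bounded_op f ->
  forall x y, inner (f x) y = inner x (adjoint f y).
Proof.
move=> [c fc] x y.
have [z fz] : exists z, forall x, inner (f x) y = inner x z.
  apply: (@riesz _ _ _ (`|c| * `|y|)) => [a x1 x2|x1].
    by rewrite linearP innerDl innerZl.
  rewrite (le_trans (cauchy_schwarz _ _))// mulrAC ler_wpM2r//.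
  by rewrite (le_trans (fc x1))// ler_wpM2r// ler_norm.
by rewrite (adjoint_eq fz).
Qed.

Lemma adjointK (f : {linear H -> K}) : bounded_op f -> adjoint (adjoint f) = f.
Proof.
move=> fb; apply/funext => x; apply: adjoint_eq => y.
by rewrite innerC -inner_adjoint// innerC.
Qed.

End Adjoint.

(** * Monotone operators *)

Section Monotone.
Context {R : realType} {V : hilbertType R}.
Implicit Types T : V -> set V.

(** Maximality tested on one added pair at a time: every pair that is
monotonically related to the graph of [T] belongs to it. *)
Definition monotone_closed T : Prop :=
  forall x b, (forall y c, T y c -> 0 <= inner (x - y) (b - c)) -> T x b.

Lemma maximal_monotone_closed T : maximal_monotone T -> monotone_closed T.
Proof.
move=> [monT maxT] x b xb.
pose T' y : set V := T y `|` [set c | y = x /\ c = b].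
suff <- : T' = T by right.
apply: maxT => [y1 y2 c1 c2|y c]; last by left.
move=> [Ty1|[-> ->]] [Ty2|[-> ->]]; first exact: monT.
- by rewrite -(opprB x) -(opprB b) innerNl innerNr opprK; exact: xb.
- exact: xb.
- by rewrite !subrr inner0l.
Qed.

(** The sufficiency half of Minty's theorem: if [v + z = x + b] with
[z \in T v], then [b - z = -(x - v)], and being monotonically related to
[(v, z)] forces [x = v] and [b = z]. *)
Lemma resolvent_monotone_closed T :
  (forall y, exists v z, T v z /\ v + z = y) -> monotone_closed T.
Proof.
move=> surj x b xb.
have [v [z [Tvz vz]]] := surj (x + b).
have bz : b - z = - (x - v).
  rewrite opprB -[z](addKr v) vz opprD opprK opprD.
  by rewrite (addrC (- x)) addrCA addNKr.
have := xb _ _ Tvz; rewrite bz innerNr oppr_ge0 => xv.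
have /eqP xv0 : x - v = 0.
  by apply: inner_eq0; apply/eqP; rewrite eq_le xv inner_ge0.
move: bz; rewrite (eqP xv0) oppr0 => /eqP; rewrite subr_eq0 => /eqP ->.
by move: xv0; rewrite subr_eq0 => /eqP ->.
Qed.

(** Demiclosedness of the graph of [T], weak in the points and strong in the
values: the limit pair [(x, 0)] is monotonically related to it. *)
Lemma weak_strong_closed T {I : Type} (F : set_system I) {FF : ProperFilter F}
    (v z : I -> V) (x : V) (M : R) :
  monotone_closed T -> (forall n, T (v n) (z n)) -> monotone_op T ->
  (forall n, `|v n| <= M) -> weak_lim F v x -> `|z n| @[n --> F] --> (0 : R) ->
  zero_of T x.
Proof.
move=> clT Tvz monT vM vx z0; apply: clT => y b Tyb.
by apply: (monotone_weak_strong_lim vM vx z0) => n; exact: monT.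
Qed.

End Monotone.

(** * The inexact proximal point iteration *)

Section InexactProximalPoint.
Context {R : realType} {V : hilbertType R}.

Lemma cvg0_bounded (f : nat -> R) : f n @[n --> \oo] --> (0 : R) ->
  exists M, forall n, `|f n| <= M.
Proof.
move=> /cvgP/cvg_seq_bounded/pinfty_ex_gt0[M _ fM].
by exists M => n; exact: fM.
Qed.

(** Expand both squares: the cross term [<v - s, z>] is nonnegative,
and what remains is the error criterion squared. *)
Lemma hpe_fejer (sigma lam : R) (w z v s : V) : 0 <= sigma -> 0 <= lam ->
  0 <= inner (v - s) z ->
  `|lam *: z + v - w| <= sigma * `|v - w| ->
  `|w - lam *: z - s| ^+ 2 + (1 - sigma ^+ 2) * `|v - w| ^+ 2 <= `|w - s| ^+ 2.
Proof.
move=> s0 l0 vsz err.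
have err2 : `|lam *: z + (v - w)| ^+ 2 <= sigma ^+ 2 * `|v - w| ^+ 2.
  by rewrite addrA -exprMn ler_pXn2r// nnegrE// mulr_ge0.
have vszE : inner (v - s) z = inner (v - w) z + inner (w - s) z.
  by rewrite -innerDl addrA subrK.
have := mulr_ge0 l0 vsz; move: err2.
rewrite vszE (addrAC w) (norm_sqrB (w - s)) (norm_sqrD (lam *: z)).
rewrite innerZl innerZr (innerC z).
lra.
Qed.

Context (T : V -> set V) (sigma c : R) (lam : nat -> R) (w z v : nat -> V).
Context (monT : monotone_op T) (s0 : 0 <= sigma) (s1 : sigma < 1).
Context (c0 : 0 < c) (lamc : forall k, c <= lam k).
Context (Tvz : forall k, T (v k) (z k)).
Context (err : forall k,
  `|lam k *: z k + v k - w k| <= sigma * `|v k - w k|).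
Context (upd : forall k, w k.+1 = w k - lam k *: z k).

Let lam0 k : 0 <= lam k.
Proof. by rewrite (le_trans (ltW c0)). Qed.

Let onesigma : 0 < 1 - sigma ^+ 2.
Proof. by rewrite subr_gt0 expr_lt1. Qed.

Lemma hpe_step s k : zero_of T s ->
  `|w k.+1 - s| ^+ 2 + (1 - sigma ^+ 2) * `|v k - w k| ^+ 2 <= `|w k - s| ^+ 2.
Proof.
move=> Ts; rewrite upd; apply: hpe_fejer => //.
by have := monT (Tvz k) Ts; rewrite subr0.
Qed.

Lemma hpe_nonincreasing s : zero_of T s ->
  nonincreasing_seq (fun k => `|w k - s| ^+ 2).
Proof.
move=> Ts; apply/nonincreasing_seqP => k; apply: le_trans (hpe_step k Ts).
by rewrite lerDl mulr_ge0 ?sqr_ge0// ltW.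
Qed.

Lemma hpe_cvg_dist s : zero_of T s -> cvg (`|w k - s| ^+ 2 @[k --> \oo]).
Proof.
move=> Ts; apply: nonincreasing_is_cvgn; first exact: hpe_nonincreasing.
by exists 0 => _ [k _ <-]; exact: sqr_ge0.
Qed.

Lemma hpe_bounded s : zero_of T s -> forall k, `|w k| <= `|w 0%N - s| + `|s|.
Proof.
move=> Ts k; rewrite -[w k](subrK s) (le_trans (ler_normD _ _))// lerD2r.
by rewrite -(@ler_pXn2r _ 2)// ?nnegrE//; exact: (hpe_nonincreasing Ts).
Qed.

(** The decrease of the convergent sequence [|w k - s|^2] tends to [0] and
dominates [(1 - sigma^2) |v k - w k|^2]. *)
Lemma hpe_gap s : zero_of T s -> `|v k - w k| @[k --> \oo] --> (0 : R).
Proof.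
move=> Ts; have /cvg_ex[l dl] := hpe_cvg_dist Ts.
pose d k := `|w k - s| ^+ 2.
have diff : (1 - sigma ^+ 2)^-1 * (d k - d k.+1) @[k --> \oo] --> (0 : R).
  rewrite -[X in _ --> X](mulr0 (1 - sigma ^+ 2)^-1); apply: cvgMl_tmp.
  rewrite -(subrr l); apply: cvgB => //.
  by have := dl; rewrite -cvg_shiftS.
have gap2 : `|v k - w k| ^+ 2 @[k --> \oo] --> (0 : R).
  apply: (squeeze_cvgr _ (cvg_cst 0) diff); apply: nearW => k.
  by rewrite sqr_ge0 /= ler_pdivlMl// lerBrDl hpe_step.
have -> : (fun k => `|v k - w k|) = (fun k => Num.sqrt (`|v k - w k| ^+ 2)).
  by apply/funext => k; rewrite sqrtr_sqr normr_id.
rewrite -[X in _ --> X]sqrtr0.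
by apply: continuous_cvg => //; exact: sqrt_continuous.
Qed.

(** [lam k *: z k] is the difference of the error term and of [v k - w k], hence
[c |z k| <= (1 + sigma) |v k - w k|]. *)
Lemma hpe_direction s : zero_of T s -> `|z k| @[k --> \oo] --> (0 : R).
Proof.
move=> Ts; have gap := hpe_gap Ts.
have bnd : (1 + sigma) / c * `|v k - w k| @[k --> \oo] --> (0 : R).
  by rewrite -[X in _ --> X](mulr0 ((1 + sigma) / c)); apply: cvgMl_tmp.
apply: (squeeze_cvgr _ (cvg_cst 0) bnd); apply: nearW => k.
rewrite normr_ge0 /= mulrAC ler_pdivlMr// mulrC.
apply: (@le_trans _ _ `|lam k *: z k|).
  by rewrite normrZ ler_wpM2r// (le_trans (lamc k))// ler_norm.
have -> : lam k *: z k = (lam k *: z k + v k - w k) - (v k - w k).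
  by rewrite opprB addrA subrK addrK.
by rewrite (le_trans (ler_normB _ _))// mulrDl mul1r addrC lerD2l.
Qed.

Lemma hpe_weak_cvg s : zero_of T s -> monotone_closed T ->
  exists2 l, zero_of T l & weakly_cvg w l.
Proof.
move=> Ts clT; apply: (opial (hpe_bounded Ts)) => [s' Ts'|U l UU ooU wl].
  exact: hpe_cvg_dist.
have gap := hpe_gap Ts.
have [M gapM] := cvg0_bounded gap.
have vM k : `|v k| <= M + (`|w 0%N - s| + `|s|).
  rewrite -[v k](subrK (w k)) (le_trans (ler_normD _ _))// lerD ?hpe_bounded//.
  by rewrite -[X in X <= _]normr_id.
have sub (f : nat -> R) :
    f k @[k --> \oo] --> (0 : R) -> f k @[k --> U] --> (0 : R).
  by apply: cvg_trans; exact: cvg_app.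
apply: (weak_strong_closed clT Tvz monT vM _ (sub _ (hpe_direction Ts))).
apply: weak_lim_near wl; apply: sub.
by under eq_fun do rewrite distrC.
Qed.

End InexactProximalPoint.

(** * The parallel composition and the degenerate method *)

Section ParallelComposition.
Context {R : realType} {H D : hilbertType R}.
Context (A : H -> set H) (C : {linear D -> H}).
Context (C_bounded : bounded_op C).

Local Notation B := (parallel_composition (adjoint C) A).
Local Notation M := (C \o adjoint C).

Lemma parallel_compositionP v z :
  B v z <-> exists2 u, A u (C z) & adjoint C u = v.
Proof.
rewrite /parallel_composition adjointK//; split.
  by move=> [u [_ -> Au] ->]; exists u.
by move=> [u Au <-]; exists u => //; exists (C z).
Qed.

Lemma parallel_composition_monotone : monotone_op A -> monotone_op B.
Proof.
move=> monA v v' z z'.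
move=> /parallel_compositionP[u Au <-] /parallel_compositionP[u' Au' <-].
have := monA _ _ _ _ Au Au'; rewrite -linearB (innerC (u - u')) inner_adjoint//.
suff -> : adjoint C (u - u') = adjoint C u - adjoint C u' by rewrite innerC.
apply: adjoint_eq => x.
by rewrite !(innerDr, innerNr) !inner_adjoint.
Qed.

(** The equation [C C^* x - C C^* u \in A u], solvable for every [x], says that
[C^* x - C^* u] belongs to the parallel composition at [C^* u]. *)
Lemma parallel_composition_surj : range (adjoint C) = [set: D] ->
    full_domain (mv_comp (mv_inv (mv_add (mv_of_fun M) A)) (mv_of_fun M)) ->
  forall y, exists v z, B v z /\ v + z = y.
Proof.
move=> onto dom y; have [x _ <-] : range (adjoint C) y by rewrite onto.
have [u [_ -> [_ -> [q Aq /= Mq]]]] := dom x.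
exists (adjoint C u), (adjoint C x - adjoint C u).
split; last by rewrite addrC subrK.
apply/parallel_compositionP; exists u => //.
by rewrite linearB -Mq addrC addKr.
Qed.

Lemma weak_lim_adjoint {I : Type} (F : set_system I) (u : I -> H) (l : H) :
  weak_lim F u l -> weak_lim F (adjoint C \o u) (adjoint C l).
Proof.
move=> ul y; rewrite innerC -inner_adjoint// innerC.
rewrite (_ : (fun n => _) = (fun n => inner (u n) (C y))); first exact: ul.
by apply/funext => n /=; rewrite innerC -inner_adjoint// innerC.
Qed.

End ParallelComposition.

Theorem theorem2p7 (R : realType) (H D : hilbertType R)
  (A : H -> set H) (C : {linear D -> H})
  (A_maxmon : maximal_monotone A)
  (A_zero : exists u : H, zero_of A u)
  (C_bounded : bounded_op C)
  (C_inj : injective C)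
  (Cadj_onto : range (adjoint C) = [set: D])
  (CC_admissible : admissible_preconditioner A (C \o adjoint C))
  (sigma : R) (sigma_ge0 : 0 <= sigma) (sigma_lt1 : sigma < 1)
  (* lambda, z and u are indexed from 1: their values at 0 are not used *)
  (lambda : nat -> R)
  (lambda_gt0 : forall k, 0 < lambda k.+1)
  (lambda_inf : 0 < inf [set lambda k.+1 | k in [set: nat]])
  (w z : nat -> D) (u : nat -> H)
  (inclusion : forall k, A (u k.+1) (C (z k.+1)))
  (rel_error : forall k,
    `|lambda k.+1 *: z k.+1 + adjoint C (u k.+1) - w k|
      <= sigma * `|adjoint C (u k.+1) - w k|)
  (update : forall k, w k.+1 = w k - lambda k.+1 *: z k.+1) :
  exists wstar : D,
    [/\ weakly_cvg w wstar,
        zero_of (parallel_composition (adjoint C) A) wstar &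
        exists ustar : H,
          [/\ mv_inv (mv_add (mv_of_fun (C \o adjoint C)) A) (C wstar)
                = [set ustar],
              zero_of A ustar &
              lipschitz_op (mv_inv (mv_add (mv_of_fun (C \o adjoint C)) A)) ->
              weakly_cvg u ustar]].
Proof.
pose B := parallel_composition (adjoint C) A.
pose P := mv_inv (mv_add (mv_of_fun (C \o adjoint C)) A).
have [_ _ _ _ [PM_single PM_full]] := CC_admissible.
have [monA _] := A_maxmon.
have clA := maximal_monotone_closed A_maxmon.
have monB : monotone_op B := parallel_composition_monotone C_bounded monA.
have clB : monotone_closed B.
  apply: resolvent_monotone_closed.
  exact: (parallel_composition_surj C_bounded Cadj_onto PM_full).
have zeroB x : zero_of A x -> zero_of B (adjoint C x).
  by move=> Ax; apply/parallel_compositionP => //; exists x; rewrite ?linear0.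
have [u0 /zeroB Bs] := A_zero.
pose lam k := lambda k.+1.
pose c := inf [set lambda k.+1 | k in [set: nat]].
have lamc k : c <= lam k.
  by apply: ge_inf; [exists 0 => _ [j _ <-]; exact: ltW|exists k].
pose z' k := z k.+1; pose u' k := u k.+1; pose v k := adjoint C (u' k).
have Bvz k : B (v k) (z' k).
  by apply/parallel_compositionP => //; exists (u' k) => //; exact: inclusion.
have [wstar Bw wcvg] :=
  hpe_weak_cvg monB sigma_ge0 sigma_lt1 lambda_inf lamc Bvz rel_error
  update Bs clB.
have gap := hpe_gap monB sigma_ge0 sigma_lt1 lambda_inf lamc Bvz rel_error
  update Bs.
have dir := hpe_direction monB sigma_ge0 sigma_lt1 lambda_inf lamc Bvz rel_error
  update Bs.
have wbnd := hpe_bounded monB sigma_ge0 sigma_lt1 lambda_inf lamc Bvz rel_error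
  update Bs.
exists wstar; split => //.
have /parallel_compositionP := Bw; move=> /(_ C_bounded) [ustar].
rewrite linear0 => Aus Cus.
have Pus x : A x 0 -> adjoint C x = wstar -> P (C wstar) x.
  move=> Ax Cx; exists (C wstar); first by rewrite /mv_of_fun/= Cx.
  by exists 0; rewrite ?addr0.
(* C wstar is in the range of C C^*, where (C C^* + A)^-1 is single-valued *)
have Puniq x : P (C wstar) x -> x = ustar.
  have [xw _ xwE] : range (adjoint C) wstar by rewrite Cadj_onto.
  move=> Px; apply: (PM_single xw).
    by exists (C wstar) => //=; rewrite /mv_of_fun/= xwE.
  by exists (C wstar); [rewrite /mv_of_fun/= xwE|exact: Pus].
exists ustar; split => //.
  by apply/seteqP; split => x /=; [exact: Puniq|move=> ->; exact: Pus].
move=> [_ [L Llip]].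
have [Mz zM] := cvg0_bounded dir.
have [Mg gM] := cvg0_bounded gap.
have [cC CC] := C_bounded.
have [Mw wM] : exists Mw, forall k, `|w k| <= Mw by eexists; exact: wbnd.
(* hence u' k stays within |L| |C (z' k + v k - wstar)| of ustar *)
have Pu k : P (C (z' k + v k)) (u' k).
  exists (C (v k)) => //; exists (C (z' k)); first exact: inclusion.
  by rewrite linearD addrC.
have uM k : `|u' k| <= `|L| * (`|cC| * (Mz + (Mg + Mw) + `|wstar|)) + `|ustar|.
  rewrite -[u' k](subrK ustar) (le_trans (ler_normD _ _))// lerD2r.
  rewrite (le_trans (Llip _ _ _ _ (Pu k) (Pus _ Aus Cus)))//.
  rewrite (le_trans (ler_wpM2r _ (ler_norm L)))// ler_wpM2l// -linearB.
  rewrite (le_trans (CC _))// (le_trans (ler_wpM2r _ (ler_norm cC)))//.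
  rewrite ler_wpM2l//.
  rewrite (le_trans (ler_normB _ _))// lerD2r (le_trans (ler_normD _ _))//.
  apply: lerD; first by have := zM k; rewrite normr_id.
  rewrite -[v k](subrK (w k)) (le_trans (ler_normD _ _))// lerD//.
  by have := gM k; rewrite normr_id.
suff : weakly_cvg u' ustar by move=> u'cvg y; rewrite -cvg_shiftS; exact: u'cvg.
apply: (weakly_cvg_ultra uM) => U l UU ooU ul.
have toU (f : nat -> R) :
    f k @[k --> \oo] --> (0 : R) -> f k @[k --> U] --> (0 : R).
  by apply: cvg_trans; exact: cvg_app.
apply/Puniq/Pus.
  have CzU : `|C (z' k)| @[k --> U] --> (0 : R).
    have bnd : cC * `|z' k| @[k --> U] --> (0 : R).
      by rewrite -[X in _ --> X](mulr0 cC); apply: cvgMl_tmp; exact: toU.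
    apply: (squeeze_cvgr _ (cvg_cst 0) bnd); apply: nearW => k.
    by rewrite normr_ge0 CC.
  exact: (weak_strong_closed clA (fun k => inclusion k) monA uM ul CzU).
apply: (weak_lim_unique (weak_lim_adjoint C_bounded ul)).
have wU : weak_lim U w wstar := weak_lim_sub ooU wcvg.
apply: weak_lim_near wU; apply: toU.
rewrite (_ : (fun k => _) = (fun k => `|v k - w k|))//.
by apply/funext => k; rewrite distrC.
Qed.
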